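(* Let $K\subsetneq L$ be a finite extension of fields, and let $G=L^\times/K^\times$ be the associated projective independence group. Then $$\mu(G)=\min\bigl\{[F:K]:K\subsetneq F\subseteq L\text{ is an intermediate field}\bigr\}.$$ Moreover, $G$ has the matching property if and only if the extension $K\subsetneq L$ has no nontrivial proper intermediate field (that is, no field $F$ with $K\subsetneq F\subsetneq L$).
   Context: A finitary matroid is a pair $(E,\mathcal{I})$ consisting of a set $E$ and a nonempty collection $\mathcal{I}$ of subsets of $E$ (called the independent sets) such that: (I1) if $A\in\mathcal{I}$ and $B\subseteq A$ then $B\in\mathcal{I}$; (I2) if $A,B$ are finite elements of $\mathcal{I}$ with $|B|=|A|+1$, then there is $x\in B\setminus A$ with $\{x\}\cup A\in\mathcal{I}$; (I3) if $A\subseteq E$ and every finite subset of $A$ belongs to $\mathcal{I}$, then $A\in\mathcal{I}$. The collection $\mathcal{I}$ is called an independence structure on $E$. A basis of a subset $A\subseteq E$ is an inclusion-maximal independent subset of $A$; any two bases of $A$ have the same cardinality, and the rank $\rho(A)$ is that cardinal number; $A$ has finite rank, written $\rho(A)<\infty$, if $\rho(A)$ is a nonnegative integer. An element $x\in E$ depends on $A\subseteq E$ if either $x\in A$, or $x\notin A$ and $\{x\}\cup B\notin\mathcal{I}$ for some independent $B\subseteq A$. The closure is $\operatorname{cl}(A)=\{x\in E: x\text{ depends on }A\}$, and $A$ is a flat if $\operatorname{cl}(A)=A$. An independence group is a group $G$ (written multiplicatively, with identity $1$) together with an independence structure $\mathcal{I}$ on the set $G$ such that for every $g\in G$ and $A\subseteq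 G$ one has $gA\in\mathcal{I}$ if and only if $A\in\mathcal{I}$, where $gA=\{gx:x\in A\}$. A submonoid of $G$ is a subset containing $1$ and closed under multiplication. The projective independence group of a field extension $K\subsetneq L$ is the group $G=L^\times/K^\times$ with the independence structure $\mathcal{I}$ consisting of all projectively independent subsets: $A\subseteq L^\times/K^\times$ is projectively independent if for one (and hence every) choice of representatives $x_a\in a$ (one for each $a\in A$), the set $\{x_a:a\in A\}$ is linearly independent over $K$. The submonoid-rank threshold of an independence group $G$ is $$\mu(G)=\min\Bigl(\bigl\{\rho(H):H\text{ is a submonoid of }G\text{ and }1<\rho(H)<\infty\bigr\}\cup\{\infty\}\Bigr).$$ Let $A,B$ be subsets of $G$ with $\rho(A)=\rho(B)$ finite. $A$ is matched to $B$ if for every basis $\mathcal{A}$ of $A$ and every basis $\mathcal{B}$ of $B$ there exists a bijection $f:\mathcal{A}\to\mathcal{B}$ such that $af(a)\notin A$ for all $a\in\mathcal{A}$. The independence group $G$ has the matching property if for every pair $(A,B)$ of finite-rank flats of $G$ with $\rho(A)=\rho(B)$ and $1\notin B$, $A$ is matched to $B$. *)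

(* Defs.v *)
From HB Require Import structures.
From mathcomp Require Import all_boot all_algebra falgebra fieldext.
From mathcomp Require Import generic_quotient.
From mathcomp Require Import boolp classical_sets functions cardinality.

Set Implicit Arguments.
Unset Strict Implicit.
Unset Printing Implicit Defensive.

Import GRing.Theory.

Local Open Scope classical_set_scope.
Local Open Scope card_scope.
Local Open Scope quotient_scope.

(* Extended natural numbers, [None] standing for infinity. *)
Notation enat := (option nat).
Notation einfty := (None : enat).

Definition enat_le (x y : enat) : bool :=
  match x, y with
  | _, None => true
  | None, Some _ => false
  | Some m, Some n => (m <= n)%N
  end.

Definition enat_lt (x y : enat) : bool := ~~ enat_le y x.

Definition is_enat_min (S : set enat) (m : enat) : Prop :=
  S m /\ forall s, S s -> enat_le m s.

(* The default value is only taken for [S = set0], see [enat_minP]. *)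
Definition enat_min (S : set enat) : enat := xget einfty (is_enat_min S).

Lemma enat_minP (S : set enat) : S !=set0 -> is_enat_min S (enat_min S).
Proof.
move=> [s Ss]; suff [m Sm] : exists m, is_enat_min S m by exact: xgetI Sm.
have [hS|hS] := pselect (exists n, S (Some n)).
  have hS' : exists n, `[< S (Some n) >] by case: hS => n Sn; exists n; apply/asboolP.
  exists (Some (ex_minn hS')); case: ex_minnP => m /asboolP Sm hm; split=> //.
  by case=> [n|] //= Sn; apply: hm; apply/asboolP.
case: s Ss => [n Sn|SN]; first by case: hS; exists n.
by exists None; split=> // -[n Sn|//]; case: hS; exists n.
Qed.

(* Cardinality of a set, all infinite cardinals being identified. *)
Definition ecard (T : Type) (A : set T) : enat :=
  xget einfty [set Some n | n in [set n | A #= `I_n]].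

Lemma ecard_fin (T : Type) (A : set T) n : A #= `I_n -> ecard A = Some n.
Proof.
move=> An; rewrite /ecard; case: xgetP => [x _ [m /= Am <-]|/(_ (Some n))].
  by congr Some; apply/card_eq_II; rewrite -(card_eql Am).
by case; exists n.
Qed.

Lemma ecard_inf (T : Type) (A : set T) : infinite_set A -> ecard A = einfty.
Proof.
move=> Ainf; rewrite /ecard; case: xgetP => // x _ [m /= Am _].
by case: Ainf; apply/finite_setP; exists m.
Qed.

Record finitary_matroid (E : Type) (I : set (set E)) : Prop := FinitaryMatroid {
  indep_ex : I !=set0;
  indep_sub : forall A B, I A -> B `<=` A -> I B;
  indep_exchange : forall A B n, I A -> I B -> A #= `I_n -> B #= `I_n.+1 ->
    exists2 x, (B `\` A) x & I (x |` A);
  indep_finitary : forall A,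
    (forall B, finite_set B -> B `<=` A -> I B) -> I A
}.

Section Matroid.
Variables (E : Type) (I : set (set E)).
Implicit Types A B : set E.

Definition is_basis A B : Prop :=
  [/\ I B, B `<=` A & forall C, I C -> C `<=` A -> B `<=` C -> C = B].

Definition rho A : enat := xget einfty [set ecard B | B in is_basis A].

Definition depends A (x : E) : Prop :=
  A x \/ (~ A x /\ exists B, [/\ I B, B `<=` A & ~ I (x |` B)]).

Definition cl A : set E := [set x | depends A x].

Definition flat A : Prop := cl A = A.

End Matroid.

(* Every set has a basis and all its bases have the same cardinality, so the
   default value in [rho] is never taken. *)
Section RankWellDefined.
Variables (E : Type) (I : set (set E)).
Hypothesis mI : finitary_matroid I.

Lemma basis_card A B C n :
  is_basis I A B -> B #= `I_n -> I C -> C `<=` A -> C #<= `I_n.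
Proof.
move=> [IB BA maxB] Bn IC CA; apply: contrapT => nCn.
have Cn : `I_n.+1 #<= C.
  have [/finite_setP[m Cm]|Cinf] := pselect (finite_set C).
    rewrite (card_le_eqr Cm) card_le_II ltnNge; apply/negP => mn.
    by apply: nCn; rewrite (card_le_eql Cm) card_le_II.
  exact/card_le_trans/infiniteP/Cinf/subset_card_le.
have [D DC Dn] : exists2 D, D `<=` C & D #= `I_n.+1.
  have [f] := card_leP Cn; pose g x : E := set_val (f x).
  exists (g @` [set: `I_n.+1]) => [_ [x _ <-]|]; first exact: set_valP.
  apply: card_eq_trans (card_setT _); apply: inj_card_eq => x y _ _ /val_inj.
  by move/inj; apply; rewrite in_setT.
have [x [Dx nBx] IxB] := indep_exchange mI IB (indep_sub mI IC DC) Bn Dn.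
apply: nBx; rewrite -(maxB _ IxB); first by left.
- by move=> y [->|/BA//]; exact/CA/DC.
- by move=> y By; right.
Qed.

Lemma rhoP A B : is_basis I A B -> rho I A = ecard B.
Proof.
move=> bB; rewrite /rho.
case: xgetP => [r _ [C bC <-]|/(_ (ecard B))]; last by case; exists B.
have [[IB BA _] [IC CA _]] := (bB, bC).
have fincase X Y : is_basis I A X -> is_basis I A Y -> finite_set X ->
    ecard X = ecard Y.
  move=> bX bY /finite_setP[n Xn]; have [[IX XA _] [IY YA _]] := (bX, bY).
  have Yn := basis_card bX Xn IY YA.
  have /finite_setP[m Ym] : finite_set Y by apply/finite_set_leP; exists n.
  have := basis_card bY Ym IX XA; rewrite (card_le_eql Xn) card_le_II => nm.
  move: Yn; rewrite (card_le_eql Ym) card_le_II => mn.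
  by rewrite (ecard_fin Xn) (ecard_fin Ym); congr Some; apply/eqP; rewrite eqn_leq nm mn.
have [Bf|Bi] := pselect (finite_set B); first by rewrite (fincase B C).
have [Cf|Ci] := pselect (finite_set C); first by rewrite (fincase C B).
by rewrite !ecard_inf.
Qed.

Lemma basis_exists A : exists B, is_basis I A B.
Proof.
suff chainP F : F `<=` [set B | I B /\ B `<=` A] -> total_on F subset ->
    I (\bigcup_(X in F) X) /\ \bigcup_(X in F) X `<=` A.
  have [B [[IB BA] maxB]] := Zorn_bigcup chainP.
  exists B; split=> // C IC CA BC; apply: contrapT => CB.
  by apply: (maxB C) => //; split=> // CB'; apply: CB; apply/seteqP.
move=> FP Ftot; split; last by move=> x [X FX Xx]; exact: (FP X FX).2.
have I0 : I set0 by have [B IB] := indep_ex mI; exact: indep_sub IB (sub0set _).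
apply: (indep_finitary mI) => B /(@finite_seqP {classic E})[s ->] {B} sF.
suff [s0|[X FX sX]] :
    (forall x, x \in s -> False) \/ exists2 X, F X & [set` s] `<=` X.
- by apply: (indep_sub mI I0) => x /= /s0.
- by apply: (indep_sub mI _ sX); exact: (FP X FX).1.
elim: s sF => [|x s IHs] sF; [by left|right].
have [X FX Xx] : (\bigcup_(X in F) X) x by apply: sF; rewrite /= mem_head.
have [|s0|[Y FY sY]] := IHs.
- by move=> y ys; apply: sF; rewrite /= inE; apply/orP; right.
- by exists X => // y; rewrite /= inE => /orP[/eqP->//|/s0].
have [XY|YX] := Ftot X Y FX FY.
- by exists Y => // y; rewrite /= inE => /orP[/eqP->|/sY//]; exact: XY.
- by exists X => // y; rewrite /= inE => /orP[/eqP->//|/sY/YX].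
Qed.

End RankWellDefined.

Record indepGroup := IndepGroup {
  igroup :> groupType;
  indep : set (set igroup);
  indep_matroid : finitary_matroid indep;
  indep_translate : forall (g : igroup) (A : set igroup),
    indep [set (g * x)%g | x in A] <-> indep A
}.

Section IndependenceGroup.
Variable G : indepGroup.
Implicit Types A B H : set G.

Definition submonoid H : Prop :=
  H 1%g /\ forall x y, H x -> H y -> H (x * y)%g.

Definition mu : enat :=
  enat_min
    ([set rho (@indep G) H | H in
       [set H | [/\ submonoid H, enat_lt (Some 1%N) (rho (@indep G) H)
                  & enat_lt (rho (@indep G) H) einfty]]]
     `|` [set einfty]).

(* [f] is only relevant on [bA]. *)
Definition matched A B : Prop :=
  forall bA bB : set G,
    is_basis (@indep G) A bA -> is_basis (@indep G) B bB ->
    exists f : G -> G, set_bij bA bB f /\ forall a, bA a -> ~ A (a * f a)%g.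

Definition matching_property : Prop :=
  forall A B : set G,
    flat (@indep G) A -> flat (@indep G) B ->
    enat_lt (rho (@indep G) A) einfty ->
    rho (@indep G) A = rho (@indep G) B ->
    ~ B 1%g -> matched A B.

End IndependenceGroup.

Local Open Scope ring_scope.

Section Units.
Variable R : unitRingType.

Record units := Units { units_val :> R; units_valP : units_val \is a GRing.unit }.

HB.instance Definition _ := [isSub for units_val].
HB.instance Definition _ := [Choice of units by <:].

Definition units_one := Units (unitr1 R).

Fact units_mul_subproof (x y : units) : units_val x * units_val y \is a GRing.unit.
Proof. by rewrite unitrMl ?units_valP. Qed.
Definition units_mul (x y : units) := Units (units_mul_subproof x y).

Fact units_inv_subproof (x : units) : (units_val x)^-1 \is a GRing.unit.
Proof. by rewrite unitrV units_valP. Qed.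
Definition units_inv (x : units) := Units (units_inv_subproof x).

Fact units_mulA : associative units_mul.
Proof. by move=> x y z; apply/val_inj/mulrA. Qed.
Fact units_mul1 : left_id units_one units_mul.
Proof. by move=> x; apply/val_inj/mul1r. Qed.
Fact units_mulr1 : right_id units_one units_mul.
Proof. by move=> x; apply/val_inj/mulr1. Qed.
Fact units_mulV : left_inverse units_one units_inv units_mul.
Proof. by move=> x; apply/val_inj/mulVr/units_valP. Qed.
Fact units_mulrV : right_inverse units_one units_inv units_mul.
Proof. by move=> x; apply/val_inj/mulrV/units_valP. Qed.

HB.instance Definition _ := isGroup.Build units
  units_mulA units_mul1 units_mulr1 units_mulV units_mulrV.

End Units.

Section ProjectiveGroup.
Variables (K : fieldType) (L : fieldExtType K).
Implicit Types x y z : units L.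

(* [1%AS] is the image of K in L, so this is congruence modulo K^*. *)
Definition proj_eq x y : bool := (val x)^-1 * val y \in (1%AS : {subfield L}).

Fact proj_eq_equiv : equiv_class_of proj_eq.
Proof.
split=> [x|x y|y x z]; rewrite /proj_eq.
- by rewrite mulVr ?units_valP // rpred1.
- by rewrite -[in RHS]rpredV invrM ?unitrV ?units_valP // invrK.
- move=> xy yz; rewrite -[val z](mulVKr (units_valP y)) mulrA.
  exact: rpredM.
Qed.

Canonical proj_eq_rel := EquivRelPack proj_eq_equiv.
Canonical proj_eq_encModRel := defaultEncModRel proj_eq.

Definition proj_group := {eq_quot proj_eq}.

HB.instance Definition _ : EqQuotient _ proj_eq proj_group :=
  EqQuotient.on proj_group.
HB.instance Definition _ := Choice.on proj_group.

Definition proj_one : proj_group := lift_cst proj_group 1%g.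
Definition proj_mul := lift_op2 proj_group (fun x y => x * y)%g.
Definition proj_inv := lift_op1 proj_group (fun x => x^-1)%g.

Canonical pi_proj_one_morph := PiConst proj_one.

Lemma proj_eqP x y : (\pi_proj_group x == \pi_proj_group y) = proj_eq x y.
Proof. by rewrite piE. Qed.

Lemma pi_proj_mul : {morph \pi_proj_group : x y / (x * y)%g >-> proj_mul x y}.
Proof.
move=> x y; unlock proj_mul; apply/eqP; rewrite proj_eqP /proj_eq /=.
have hx : proj_eq x (repr (\pi_proj_group x)) by rewrite -proj_eqP reprK.
have hy : proj_eq y (repr (\pi_proj_group y)) by rewrite -proj_eqP reprK.
by rewrite invrM ?units_valP // [_^-1 * _]mulrC mulrACA; exact: rpredM.
Qed.
Canonical pi_proj_mul_morph := PiMorph2 pi_proj_mul.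

Lemma pi_proj_inv : {morph \pi_proj_group : x / x^-1%g >-> proj_inv x}.
Proof.
move=> x; unlock proj_inv; apply/eqP; rewrite proj_eqP /proj_eq /=.
have : proj_eq (repr (\pi_proj_group x)) x by rewrite -proj_eqP reprK.
by rewrite /proj_eq invrK mulrC.
Qed.
Canonical pi_proj_inv_morph := PiMorph1 pi_proj_inv.

Fact proj_mulA : associative proj_mul.
Proof. by move=> x y z; rewrite -[x]reprK -[y]reprK -[z]reprK !piE mulgA. Qed.
Fact proj_mul1g : left_id proj_one proj_mul.
Proof. by move=> x; rewrite -[x]reprK !piE mul1g. Qed.
Fact proj_mulg1 : right_id proj_one proj_mul.
Proof. by move=> x; rewrite -[x]reprK !piE mulg1. Qed.
Fact proj_mulVg : left_inverse proj_one proj_inv proj_mul.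
Proof. by move=> x; rewrite -[x]reprK !piE mulVg. Qed.
Fact proj_mulgV : right_inverse proj_one proj_inv proj_mul.
Proof. by move=> x; rewrite -[x]reprK !piE mulgV. Qed.

HB.instance Definition _ := isGroup.Build proj_group
  proj_mulA proj_mul1g proj_mulg1 proj_mulVg proj_mulgV.

Lemma proj_mulE x y :
  \pi_proj_group (x * y)%g = (\pi_proj_group x * \pi_proj_group y)%g.
Proof. exact: pi_proj_mul. Qed.

Definition lin_indep (S : set L) : Prop :=
  forall s : seq L, uniq s -> [set` s] `<=` S -> free s.

Definition represents (A : set proj_group) (r : proj_group -> units L) : Prop :=
  forall a, A a -> \pi_proj_group (r a) = a.

Definition proj_indep (A : set proj_group) : Prop :=
  exists2 r, represents A r & lin_indep [set val (r a) | a in A].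

Lemma units_neq0 x : val x != 0.
Proof. by rewrite -unitfE units_valP. Qed.

Lemma represents_val (A : set proj_group) r a : represents A r -> A a ->
  exists2 k : K, k != 0 & val (r a) = k *: val (repr a).
Proof.
move=> rA Aa; have : proj_eq (repr a) (r a) by rewrite -proj_eqP reprK rA.
rewrite /proj_eq => /vlineP[k hk]; exists k.
  apply/eqP => k0; move: hk; rewrite k0 scale0r => /eqP.
  by rewrite mulf_eq0 invr_eq0 (negPf (units_neq0 _)) (negPf (units_neq0 _)).
by rewrite -[LHS](mulVKr (units_valP (repr a))) hk -scalerAr mulr1.
Qed.

Lemma represents_inj (A : set proj_group) r a b : represents A r -> A a -> A b ->
  val (r a) = val (r b) -> a = b.
Proof. by move=> rA Aa Ab /val_inj rab; rewrite -(rA _ Aa) -(rA _ Ab) rab. Qed.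

Lemma lin_indepP (A : set proj_group) r : represents A r ->
  lin_indep [set val (r a) | a in A] <->
  forall t : seq proj_group, uniq t -> [set` t] `<=` A ->
    free [seq val (r a) | a <- t].
Proof.
move=> rA; split=> h t ut tA.
  apply: h; last by move=> _ /= /mapP[a /tA Aa ->]; exists a.
  rewrite map_inj_in_uniq // => a b /tA Aa /tA Ab; exact: represents_inj rA Aa Ab.
pose u := [seq \pi_proj_group (insubd (1%g : units L) v) | v <- t].
have ur : [seq val (r a) | a <- u] = t.
  rewrite -map_comp -[RHS]map_id; apply/eq_in_map => v /tA[a Aa <-] /=.
  by rewrite valKd rA.
rewrite -ur; apply: h; first by rewrite -ur in ut; exact: map_uniq ut.
by move=> _ /= /mapP[v /tA[a Aa <-] ->]; rewrite valKd rA.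
Qed.

Lemma span_free_scale (I : eqType) (t : seq I) (v w : I -> L) :
  (forall i, i \in t -> exists2 k : K, k != 0 & v i = k *: w i) ->
  (<<[seq v i | i <- t]>> = <<[seq w i | i <- t]>>)%VS /\
  free [seq v i | i <- t] = free [seq w i | i <- t].
Proof.
elim: t => [|i t IHt] // h.
have [|sp fr] := IHt; first by move=> j jt; apply: h; rewrite inE jt orbT.
have [k k0 vi] := h i (mem_head _ _).
have lE : <[k *: w i]>%VS = <[w i]>%VS.
  apply/eqP; rewrite eqEsubv -!memvE memvZ ?memv_line //=.
  by rewrite -{1}[w i](scalerK k0) memvZ ?memv_line.
rewrite /= !span_cons !free_cons vi sp fr lE; split=> //.
by rewrite !memvE lE.
Qed.

(* Projective independence does not depend on the choice of representatives. *)
Lemma proj_indepP (A : set proj_group) r : represents A r ->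
  proj_indep A <-> lin_indep [set val (r a) | a in A].
Proof.
move=> rA; split=> [[r' r'A]|h]; last by exists r.
have hrep q : represents A q ->
    lin_indep [set val (q a) | a in A] <->
    lin_indep [set val (repr a) | a in A].
  have reprA : represents A (repr : proj_group -> units L).
    by move=> a _; exact: reprK.
  move=> qA; rewrite (lin_indepP qA) (lin_indepP reprA).
  split=> h t ut tA; have := h t ut tA;
  by rewrite (span_free_scale (fun i it => represents_val qA (tA i it))).2.
by move/hrep => /(_ r'A) => h; apply/hrep.
Qed.

Definition reprs (t : seq proj_group) : seq L := [seq val (repr a) | a <- t].

Lemma proj_indepE (A : set proj_group) :
  proj_indep A <->
  forall t : seq proj_group, uniq t -> [set` t] `<=` A -> free (reprs t).
Proof.
have reprA : represents A (repr : proj_group -> units L).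
  by move=> a _; exact: reprK.
by rewrite (proj_indepP reprA) (lin_indepP reprA).
Qed.

Lemma proj_indep_seq (s : seq proj_group) : uniq s ->
  proj_indep [set` s] <-> free (reprs s).
Proof.
move=> us; rewrite proj_indepE; split=> [h|fs t ut ts]; first exact: h.
have /perm_free-> : perm_eq (reprs t) (reprs [seq x <- s | x \in t]).
  apply/perm_map/uniq_perm => //; first exact: filter_uniq.
  by move=> x; rewrite mem_filter; case: (boolP (x \in t)) => //= /ts ->.
have : perm_eq s ([seq x <- s | x \in t] ++ [seq x <- s | x \notin t]).
  by rewrite perm_sym perm_filterC.
by move=> /(perm_map (fun a => val (repr a)))/perm_free; rewrite -/(reprs _) fs map_cat
  => /esym/catl_free.
Qed.

Lemma card_uniq_seq (T : choiceType) (C : set T) n : C #= `I_n ->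
  exists s : seq T, [/\ uniq s, C = [set` s] & size s = n].
Proof.
move=> Cn; have /finite_fsetP[X CX] : finite_set C.
  by apply/finite_setP; exists n.
exists (finmap.enum_fset X); split=> //.
by apply/card_eq_fsetP; rewrite -CX.
Qed.

Lemma proj_matroid : finitary_matroid proj_indep.
Proof.
split.
- exists set0; apply/proj_indepE => -[|x t] _ h; first exact: nil_free.
  by have := h x (mem_head _ _).
- move=> A B /proj_indepE hA BA; apply/proj_indepE => t ut tB.
  by apply: hA => //; exact: subset_trans BA.
- move=> A B n IA IB /card_uniq_seq[s [us AE sn]] /card_uniq_seq[t [ut BE tn]].
  rewrite {}AE in IA *; rewrite {}BE in IB *; move/proj_indep_seq: IA => /(_ us) fs.
  move/proj_indep_seq: IB => /(_ ut) ft; apply: contrapT => nex.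
  suff : (<<reprs t>> <= <<reprs s>>)%VS.
    move/dimvS; rewrite (eqP fs) (eqP ft) !size_map sn tn => le.
    by rewrite ltnn in le.
  apply/span_subvP => _ /mapP[x xt ->]; apply: contrapT => /negP xs.
  have x_s : x \notin s.
    by apply: contra xs => x_s; apply/memv_span/map_f.
  apply: nex; exists x; first by split=> //=; exact/negP.
  have -> : x |` [set` s] = [set` x :: s].
    apply/seteqP; split=> y /=; rewrite inE.
      by move=> [->|->]; rewrite ?eqxx ?orbT.
    by move=> /orP[/eqP->|]; [left|right].
  by apply/proj_indep_seq; rewrite /= ?x_s // /reprs /= free_cons xs.
- move=> A h; apply/proj_indepE => t ut tA; apply/proj_indep_seq => //.
  exact: h.
Qed.

Lemma free_mull (u : L) (X : seq L) : u != 0 -> free X ->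
  free [seq u * v | v <- X].
Proof.
move=> u0 fX; have -> : [seq u * v | v <- X] = [seq amull u v | v <- X].
  by apply: eq_map => v; rewrite lfunE.
rewrite /free -limg_span limg_dim_eq ?size_map //.
by rewrite (eqP (lker0_amull _)) ?capv0 // unitfE.
Qed.

Lemma proj_translate (g : proj_group) (A : set proj_group) :
  proj_indep [set (g * x)%g | x in A] <-> proj_indep A.
Proof.
suff step h B : proj_indep B -> proj_indep [set (h * x)%g | x in B].
  split=> [/(step g^-1%g)|]; last exact: step.
  set B := (X in proj_indep X).
  suff -> : B = A by [].
  apply/seteqP; split=> [_ [_ [a Aa <-] <-]|a Aa]; first by rewrite mulKg.
  by exists (g * a)%g; [exists a|rewrite mulKg].
move=> [r rB]; rewrite (lin_indepP rB) => hr.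
pose q b := (repr h * r (h^-1 * b)%g)%g.
have qB : represents [set (h * x)%g | x in B] q.
  by move=> _ [b Bb <-]; rewrite /q proj_mulE reprK mulKg rB.
exists q => //; apply/(lin_indepP qB) => t ut tB.
have -> : [seq val (q b) | b <- t] =
    [seq val (repr h) * v
      | v <- [seq val (r a) | a <- [seq (h^-1 * b)%g | b <- t]]].
  by rewrite -!map_comp.
apply: free_mull; first exact: units_neq0.
apply: hr; first by rewrite map_inj_uniq //; exact: mulgI.
by move=> _ /= /mapP[_ /tB[b Bb <-] ->]; rewrite mulKg.
Qed.

Definition proj_indep_group : indepGroup :=
  IndepGroup proj_matroid proj_translate.

End ProjectiveGroup.

(* Main.v *)
Require Import Defs.
From mathcomp Require Import all_boot all_algebra falgebra fieldext.
From mathcomp Require Import generic_quotient.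
From mathcomp Require Import boolp classical_sets functions cardinality.

(** Everything reduces to linear algebra in [L]. A flat of L^*/K^* is the set
    [points V] of the lines lying in a subspace [V], its rank is [\dim V], and a
    basis of it is a vector basis of [V] taken up to scalars.

    The threshold. The vector space spanned by a submonoid is closed under
    products, and a finite-dimensional subalgebra of a field is a field; so the
    finite ranks of submonoids are exactly the degrees of the intermediate
    fields ([submonoid_rank], [points_submonoid]).

    An intermediate field K < F < L destroys matching. With [W] a complement of
    K in [F] and [x] outside [F], the flats of [F] and of <x> + W have equal
    rank and the second one avoids 1. A basis of the second contains an element
    of [W], and whatever it is matched to in [F], the product stays in [F]
    ([matching_no_proper_subfield]).

    Without intermediate fields, let [A] and [B] be the subspaces of two flats
    of rank n, with 1 outside [B]. By Hall's marriage theorem, a matching of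
    given bases can only fail because of sets u and v of basis elements, of
    total size above n, all of whose products lie in [A] ([marriage_seq]). Let
    U and W' be the spans of u and v. Since 1 is not in W', the space U(1 + W'),
    contained in [A], is a product of spaces of dimensions #|u| and #|v| + 1;
    and [A] is not [L], as otherwise [B] would be [L]. The linear analogue
    dim XY >= min(dim L, dim X + dim Y - 1) of the Cauchy-Davenport inequality
    ([linear_cauchy_davenport]) then gives #|u| + #|v| <= n, a contradiction
    ([no_proper_subfield_matching]). *)

Set Implicit Arguments.
Unset Strict Implicit.
Unset Printing Implicit Defensive.

Import GRing.Theory.

Local Open Scope classical_set_scope.

(** * Hall's marriage theorem *)

Section Hall.
Import mathcomp.boot.fintype mathcomp.boot.finset.
Variables (T U : finType).
Local Open Scope set_scope.
Local Open Scope nat_scope.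
Implicit Types (r : T -> U -> bool) (S J : {set T}).

Definition neighbors r J : {set U} := [set y | [exists x in J, r x y]].

Lemma neighborsP r J y : reflect (exists2 x, x \in J & r x y) (y \in neighbors r J).
Proof. by rewrite inE; exact: exists_inP. Qed.

Definition saturating r S (f : T -> U) : Prop :=
  {in S &, injective f} /\ {in S, forall x, r x (f x)}.

(** The induction step of Hall's theorem: once [J] is matched inside [Y], it
    remains to match the rest of [S] outside [Y]. *)
Lemma saturating_glue r S J (Y : {set U}) f g : J \subset S ->
  saturating r J f -> {in J, forall x, f x \in Y} ->
  saturating (fun x y => r x y && (y \notin Y)) (S :\: J) g ->
  exists h, saturating r S h.
Proof.
move=> JS [finj fr] fY [ginj gr].
have gS x : x \in S -> x \notin J -> r x (g x) /\ g x \notin Y.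
  by move=> xS xJ; apply/andP/gr; rewrite inE xJ.
exists (fun x => if x \in J then f x else g x); split=> [x y xS yS|x xS]; last first.
  by case: ifPn => [/fr//|/(gS x xS)[]].
case: ifPn => xJ; case: ifPn => yJ.
- exact: finj.
- by move=> fg; have [_] := gS y yS yJ; rewrite -fg fY.
- by move=> fg; have [_] := gS x xS xJ; rewrite fg fY.
- by apply: ginj; rewrite inE ?xJ ?yJ.
Qed.

(** Halmos and Vaughan's induction on #|S|. If some proper nonempty [J] is
    tight, match [J] first: Hall's condition passes to [S :\: J] with the
    neighbors of [J] forbidden. If none is, any edge may be used, as deleting
    its endpoint lowers the number of neighbors of each set by at most one.
    The default [y0] only serves to have a total function. *)
Theorem hall_marriage (y0 : U) r S :
  (forall J, J \subset S -> #|J| <= #|neighbors r J|) ->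
  exists f, saturating r S f.
Proof.
have [n] := ubnP #|S|; elim: n => // n IHn in r S * => leS hallS.
have IHprop J r' : J \proper S ->
    (forall J', J' \subset J -> #|J'| <= #|neighbors r' J'|) ->
    exists f, saturating r' J f.
  by move=> /proper_card JS; apply: IHn; exact: leq_trans JS _.
have [S0|[x xS]] := set_0Vmem S.
  by exists (fun=> y0); split=> x; rewrite S0 inE.
have propD J : J \subset S -> J != set0 -> S :\: J \proper S.
  move=> JS J0; rewrite properEneq subsetDl andbT.
  by apply: contraNneq J0 => /setDidPl; rewrite disjoint_sym => /disjoint_setI0;
    rewrite (setIidPl JS) => ->.
have [/existsP[J /and3P[JS J0 tight]]|/existsPn slack] :=
    boolP [exists J : {set T}, [&& J \proper S, J != set0 & #|neighbors r J| <= #|J|]].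
  have sJS := proper_sub JS.
  have [f fP] : exists f, saturating r J f.
    by apply: IHprop => // J' J'J; apply/hallS/(subset_trans J'J).
  have [J' J'S|g gP] := IHprop _ (fun x y => r x y && (y \notin neighbors r J))
      (propD J sJS J0).
    have disj : J' :&: J = set0.
      by apply/disjoint_setI0; move: J'S; rewrite subsetD => /andP[].
    have J'S' : J' \subset S by apply: subset_trans J'S _; exact: subsetDl.
    rewrite -(leq_add2r #|J|) -cardsUI disj cards0 addn0.
    apply: leq_trans (hallS _ _) _; first by rewrite subUset J'S'.
    apply: leq_trans (leq_add (leqnn _) tight); rewrite -cardsUI.
    apply: leq_trans (leq_addr _ _); apply/subset_leq_card/subsetP => y.
    move=> /neighborsP[z]; rewrite !in_setU => /orP[zJ'|zJ] rzy; last first.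
      by apply/orP; right; apply/neighborsP; exists z.
    case: (boolP (y \in neighbors r J)) => [|yJ]; first by rewrite orbT.
    by rewrite orbF; apply/neighborsP; exists z => //; rewrite rzy.
  apply: (saturating_glue sJS fP _ gP) => z zJ; apply/neighborsP; exists z => //.
  exact: fP.2.
have [y rxy] : exists y, r x y.
  have : 0 < #|neighbors r [set x]|.
    by rewrite (leq_trans _ (hallS _ _)) ?cards1 // sub1set.
  by case/card_gt0P => y /neighborsP[_ /set1P->]; exists y.
have xprop : S :\: [set x] \proper S.
  by apply: propD; [rewrite sub1set|apply/set0Pn; exists x; rewrite inE].
have [J' J'S|g gP] := IHprop _ (fun x z => r x z && (z \notin [set y])) xprop.
  have [->|J'0] := eqVneq J' set0; first by rewrite cards0.
  have J'S' : J' \proper S.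
    exact: sub_proper_trans J'S xprop.
  have := slack J'; rewrite J'S' J'0 /= -ltnNge => /leq_trans lt.
  rewrite -ltnS -[ltnRHS]addn1 -(cards1 y) -cardsUI.
  apply: leq_trans (leq_addr _ _); apply: lt; apply/subset_leq_card/subsetP => z.
  move=> /neighborsP[w wJ' rwz]; rewrite in_setU.
  case: (boolP (z \in [set y])) => zy; first by rewrite orbT.
  by rewrite orbF; apply/neighborsP; exists w => //; rewrite rwz.
apply: (@saturating_glue r S [set x] [set y] (fun=> y) g) => //.
- by rewrite sub1set.
- by split=> [a b /set1P-> /set1P->//|a /set1P->].
- by move=> a _; rewrite inE.
Qed.

End Hall.

(** Hall's condition in Koenig's symmetric form: [u] is a set of vertices and
    [v] the complement of its neighborhood, so that only pairs of sublists
    without any edge between them occur. *)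
Lemma marriage_seq (T : choiceType) (r : T -> T -> bool) (s t : seq T) :
  uniq s -> uniq t -> size s = size t ->
  (forall u v, uniq u -> uniq v -> {subset u <= s} -> {subset v <= t} ->
     {in u & v, forall x y, ~~ r x y} -> (size u + size v <= size t)%N) ->
  exists f : T -> T, set_bij [set` s] [set` t] f /\ {in s, forall x, r x (f x)}.
Proof.
move=> us ut st edgeless_le.
(* The empty lists are apart: there, no element is available as a default. *)
have [s0|] := posnP (size s).
  have sn : s = [::] by exact: size0nil.
  have tn : t = [::] by apply: size0nil; rewrite -st.
  by exists id; rewrite sn tn; split=> //; split.
case s_eq : s => [//|a0 s1] _; case t_eq : t => [|b0 t1].
  by rewrite s_eq t_eq in st.
rewrite -s_eq -t_eq.
have x0 : seq_sub s by apply: (@SeqSub _ _ a0); rewrite s_eq mem_head.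
have y0 : seq_sub t by apply: (@SeqSub _ _ b0); rewrite t_eq mem_head.
pose r' (x : seq_sub s) (y : seq_sub t) := r (ssval x) (ssval y).
have uniq_vals (w : seq T) (J : {set seq_sub w}) : uniq [seq ssval x | x <- enum J].
  by rewrite map_inj_uniq ?enum_uniq //; exact: val_inj.
have hallP (J : {set seq_sub s}) : (#|J| <= #|neighbors r' J|)%N.
  rewrite -(leq_add2r #|finset.setC (neighbors r' J)|) finset.cardsC card_seq_sub //.
  rewrite [in X in (X <= _)%N]cardE [in X in (_ + X <= _)%N]cardE.
  rewrite -!(size_map (@ssval _ _)); apply: edgeless_le => //.
  - by move=> _ /mapP[x _ ->]; exact: ssvalP.
  - by move=> _ /mapP[x _ ->]; exact: ssvalP.
  move=> _ _ /mapP[x xJ ->] /mapP[y + ->]; rewrite mem_enum finset.inE.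
  by apply: contra => rxy; apply/neighborsP; exists x; rewrite // -mem_enum.
have [f [finj fr]] := hall_marriage y0 (fun J _ => hallP J) (S := finset.setT).
have {}finj : injective f by move=> x y; apply: finj; rewrite finset.inE.
have [g fK gK] : bijective f.
  by apply: inj_card_bij finj _; rewrite !card_seq_sub ?st.
have insubE a (sa : a \in s) : ssval (insubd x0 a) = a by exact: (@insubdK _ _ _ x0 a sa).
exists (fun a => ssval (f (insubd x0 a))); split; last first.
  by move=> a sa; rewrite -{1}(insubE a sa); apply: fr; rewrite finset.inE.
split.
- by move=> a _ /=; exact: ssvalP.
- move=> a b /set_mem sa /set_mem sb /val_inj/finj ab.
  by rewrite -(insubE a sa) ab insubE.
- move=> b tb; exists (ssval (g (SeqSub tb))); first exact: ssvalP.
  by rewrite valKd gK.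
Qed.

(** * Cauchy-Davenport for subspaces of a field *)

Section CauchyDavenport.
Variables (K : fieldType) (L : fieldExtType K).
Local Open Scope ring_scope.
Local Open Scope vspace_scope.
Implicit Types A B V : {vspace L}.

Lemma prodv_span_sub (X Y : seq L) V :
  (forall x y, x \in X -> y \in Y -> (x * y)%R \in V) -> <<X>> * <<Y>> <= V.
Proof.
move=> XYV; apply/prodvP => u v; rewrite -[X]/(tval (in_tuple X)).
rewrite -[Y]/(tval (in_tuple Y)).
move=> /coord_span-> /coord_span->; rewrite mulr_suml; apply: rpred_sum => i _.
rewrite mulr_sumr; apply: rpred_sum => j _.
rewrite -scalerAl -scalerAr; apply/rpredZ/rpredZ.
by apply: XYV; exact: mem_nth.
Qed.

(** The subspace form of Dyson's transform of a pair of sets; it shrinks the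
    product without lowering the sum of the dimensions. *)
Lemma dyson_transform (e : L) A B : e != 0%R ->
  let A' := A + B * <[e]> in let B' := B :&: A * <[e^-1]> in
  A' * B' <= A * B /\ (\dim A + \dim B <= \dim A' + \dim B')%N.
Proof.
move=> e0 /=; split.
  rewrite prodvDl subv_add prodvSr ?capvSl //=.
  apply: subv_trans (prodvSr _ (capvSr _ _)) _.
  rewrite prodvA [_ * A]prodvC prodvA -prodvA prodv_line divff //.
  by rewrite prodv1.
rewrite -(dim_cosetv B e0) -[leqLHS]dimv_sum_cap leq_add2l.
have e'0 : e^-1%R != 0%R by rewrite invr_eq0.
rewrite -(dim_cosetv _ e'0); apply: dimvS.
rewrite subv_cap [X in _ && X]prodvSl ?capvSl // andbT.
apply: subv_trans (prodvSl _ (capvSr _ _)) _.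
by rewrite -prodvA prodv_line divff // prodv1.
Qed.

Definition no_proper_subfield : Prop :=
  forall F : {subfield L}, F = 1%VS :> {vspace L} \/ F = fullv :> {vspace L}.

(** By induction on [\dim B]. If some nonzero [e] in [A] makes the second space
    of the Dyson transform smaller than [B], use the induction hypothesis. If
    none does, then [A * B] is contained in [A], so that [A] is stable under the
    field generated by [B]. When this field is K, [B] is K; when it is [L], the
    nonzero space [A] is [L]. *)
Theorem linear_cauchy_davenport A B : no_proper_subfield ->
  A != 0 -> 1%R \in B ->
  (minn (\dim {:L}) (\dim A + \dim B).-1 <= \dim (A * B))%N.
Proof.
move=> nosub; have [n] := ubnP (\dim B); elim: n => // n IHn in A B * => leB A0 B1.
have [stable|/existsNP[e]] :=
    pselect (forall e, e \in A -> e != 0%R -> B <= A * <[e^-1]>); last first.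
  move=> /not_implyP[eA /not_implyP[e0 /negP nBe]].
  have [sub le_dim] := dyson_transform A B e0.
  set A' := A + _ in sub le_dim; set B' := B :&: _ in sub le_dim.
  apply: leq_trans (dimvS sub).
  have A'0 : A' != 0.
    by apply: contraNneq A0 => A'0; rewrite -subv0 -A'0 addvSl.
  (* 1 = e * e^-1, and e lies in A. *)
  have B'1 : 1%R \in B'.
    by rewrite memv_cap B1 /= -(divff e0); apply: memv_mul => //; exact: memv_line.
  have ltB' : (\dim B' < n)%N.
    apply: leq_trans (_ : (\dim B <= n)%N) => //.
    rewrite ltn_neqAle dimvS ?capvSl // andbT.
    apply: contra nBe => /eqP eqd.
    have /eqP/capv_idPl : B' == B by rewrite eqEdim capvSl eqd /=.
    by [].
  apply: leq_trans (IHn A' B' ltB' A'0 B'1).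
  rewrite leq_min geq_minl /=; apply: leq_trans (geq_minr _ _) _.
  by rewrite -!subn1 leq_sub2r.
have AB : A * B <= A.
  apply/prodvP => a b aA bB; have [->|a0] := eqVneq a 0%R; first by rewrite mul0r mem0v.
  have ba : (b * a)%R \in B * <[a]> by apply: memv_mul => //; exact: memv_line.
  have := subvP (prodvSl <[a]> (stable a aA a0)) _ ba.
  by rewrite -prodvA prodv_line mulVf // prodv1 mulrC.
have AagB := agenv_modr AB.
have [B1E|BfE] := nosub (agenv_aspace B).
  have -> : B = 1 by apply/eqP; rewrite eqEsubv -memvE B1 andbT -B1E sub_agenv.
  by rewrite prodv1 dimv1 addn1 geq_minr.
apply: leq_trans (geq_minl _ _) _.
have [a aA a0] : exists2 a, a \in A & a != 0%R.
  by exists (vpick A); rewrite ?memv_pick ?vpick0.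
rewrite -(dim_cosetv _ a0); apply: dimvS; apply: (@subv_trans _ _ A).
  rewrite prodvC -BfE; apply: subv_trans AagB; apply: prodvSl.
  by rewrite -memvE.
by rewrite -{1}(prodv1 A) prodvSr // -memvE.
Qed.

End CauchyDavenport.

(** * Flats, bases and ranks of the projective independence group *)

Section Points.
Variables (K : fieldType) (L : fieldExtType K).
Local Open Scope ring_scope.
Local Open Scope quotient_scope.
Notation PG := (proj_group L).
Notation indepP := (@proj_indep K L).
Implicit Types (V W : {vspace L}) (a b : PG) (A B : set PG) (s t : seq PG).

Definition points V : set PG := [set a | val (repr a) \in V].

(** The line through [v]; for [v = 0], which spans none, it is the class of 1. *)
Definition point (v : L) : PG := \pi_PG (insubd (1%g : units L) v).

Lemma repr_pi (x : units L) :
  exists2 k : K, k != 0 & val x = k *: val (repr (\pi_PG x)).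
Proof.
by apply: (@represents_val _ _ [set \pi_PG x] (fun=> x)) => // a ->.
Qed.

Lemma points_pi V (x : units L) : points V (\pi_PG x) <-> val x \in V.
Proof.
by rewrite /points /=; have [k k0 ->] := repr_pi x; rewrite rpredZeq (negPf k0).
Qed.

Lemma points_one V : points V (1%g : PG) <-> 1 \in V.
Proof.
have -> : (1%g : PG) = \pi_PG (1%g : units L) by rewrite -[LHS]/(proj_one L) piE.
exact: points_pi.
Qed.

Lemma points_mul V a b :
  points V (a * b)%g <-> val (repr a) * val (repr b) \in V.
Proof.
rewrite -[a in points _ (a * _)%g]reprK -[b in points _ (_ * b)%g]reprK.
by rewrite -proj_mulE; exact: points_pi.
Qed.

Lemma point_repr (v : L) : v != 0 ->
  exists2 k : K, k != 0 & val (repr (point v)) = k *: v.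
Proof.
move=> v0; have [k k0] := repr_pi (insubd (1%g : units L) v).
have uv : v \is a GRing.unit by rewrite unitfE.
rewrite insubdK // => vE; exists k^-1; rewrite ?invr_eq0 //.
by rewrite [in RHS]vE scalerA mulVf // scale1r.
Qed.

Lemma points_point V v : v != 0 -> points V (point v) <-> v \in V.
Proof.
by move=> /point_repr[k k0 vE]; rewrite /points /= vE rpredZeq (negPf k0).
Qed.

Lemma reprs_point (X : seq L) : free X ->
  [/\ uniq (map point X), free (reprs (map point X))
    & <<reprs (map point X)>>%VS = <<X>>%VS].
Proof.
move=> fX; have [|sp fr] := @span_free_scale K L L X (fun v => val (repr (point v))) id.
  by move=> v /(free_not0 fX); exact: point_repr.
rewrite /reprs -map_comp sp fr map_id; split=> //.
by apply/(@map_uniq _ _ (fun a => val (repr a)))/free_uniq; rewrite -map_comp fr map_id.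
Qed.

(** An infinite independent set would contain free families longer than
    [\dim {:L}]. *)
Lemma indep_finite A : indepP A -> finite_set A.
Proof.
move=> /proj_indepE fA; apply: contrapT => /(infinite_set_fset (\dim {:L}).+1)[X XA].
rewrite ltnNge => /negP; apply.
have := fA _ (finmap.fset_uniq X) XA; rewrite /free size_map => /eqP <-.
exact/dimvS/subvf.
Qed.

Lemma basis_seq A B : is_basis indepP A B -> exists2 s, uniq s & B = [set` s].
Proof.
move=> [/indep_finite/finite_setP[n /card_uniq_seq[s [us -> _]]] _ _].
by exists s.
Qed.

Lemma basis_seqP A s : uniq s -> is_basis indepP A [set` s] <->
  [/\ free (reprs s), [set` s] `<=` A & A `<=` points <<reprs s>>].
Proof.
move=> us; split=> [[/(proj_indep_seq us) fs sA maxs]|[fs sA Asp]].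
  split=> // a Aa; apply/negPn/negP => nsp.
  have as_ : a \notin s by apply: contra nsp => ?; exact/memv_span/map_f.
  suff E : [set` a :: s] = [set` s].
    have as' : [set` a :: s] a by rewrite /= mem_head.
    by move: as'; rewrite E /= (negPf as_).
  apply: maxs.
  - by apply/proj_indep_seq; rewrite /= ?as_ // /reprs /= free_cons nsp.
  - by move=> b; rewrite /= inE => /orP[/eqP->//|/sA].
  - by move=> b /= bs; rewrite inE bs orbT.
split=> //; first exact/proj_indep_seq.
move=> C IC CA sC; apply/seteqP; split=> // a Ca; apply: contrapT => /negP as_.
have /proj_indepE/(_ (a :: s)) := IC; rewrite /= as_ us /reprs /= free_cons.
move=> /(_ isT); rewrite (Asp a (CA a Ca)) /= => notsub.
suff : false by []; apply: notsub => b; rewrite /= inE => /orP[/eqP->//|/sC//].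
Qed.

Lemma basis_seq_exists A : exists2 s, uniq s & is_basis indepP A [set` s].
Proof.
have [B bB] := basis_exists (proj_matroid L) A.
by have [s us BE] := basis_seq bB; exists s => //; rewrite -BE.
Qed.

Lemma rho_basis A s : uniq s -> is_basis indepP A [set` s] ->
  rho indepP A = Some (\dim <<reprs s>>).
Proof.
move=> us bs; have [fs _ _] := (basis_seqP A us).1 bs.
rewrite (rhoP (proj_matroid L) bs) (eqP fs) size_map; apply: ecard_fin.
have /finite_setP[n sn] := finite_seq s.
have [s' [us' ss' s'n]] := card_uniq_seq sn.
have -> : size s = n.
  rewrite -s'n; apply/perm_size/uniq_perm => // a; apply/idP/idP => as_.
    by have : [set` s] a by []; rewrite ss'.
  by have : [set` s'] a by []; rewrite -ss'.
by [].
Qed.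

Lemma rho_lt_infty A : enat_lt (rho indepP A) einfty.
Proof. by have [s us bs] := basis_seq_exists A; rewrite (rho_basis us bs). Qed.

Lemma points_basis V (X : seq L) : basis_of V X ->
  uniq (map point X) /\ is_basis indepP (points V) [set` map point X].
Proof.
move=> /andP[/eqP spX fX]; have [uX frX sX] := reprs_point fX; split=> //.
apply/basis_seqP => //; rewrite sX spX; split=> // _ /mapP[v vX ->].
by apply/points_point; [exact: free_not0 vX|rewrite -spX memv_span].
Qed.

Lemma rho_points V : rho indepP (points V) = Some (\dim V).
Proof.
have [uX bX] := points_basis (vbasisP V); rewrite (rho_basis uX bX).
by have [_ _ ->] := reprs_point (basis_free (vbasisP V));
  rewrite (span_basis (vbasisP V)).
Qed.

(** A point outside [V] depends on no independent subset of [points V], since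
    such a subset spans a subspace of [V]. *)
Lemma flat_points V : flat indepP (points V).
Proof.
apply/seteqP; split=> a; last by left.
case=> // -[nVa [B [IB BV nIaB]]]; case: nIaB.
have /finite_setP[n /card_uniq_seq[s [us BE _]]] := indep_finite IB.
have spV : (<<reprs s>> <= V)%VS.
  by apply/span_subvP => _ /mapP[b bs ->]; apply: BV; rewrite BE.
have as_ : a \notin s by apply/negP => as_; apply: nVa; apply: BV; rewrite BE.
have -> : a |` B = [set` a :: s].
  by apply/seteqP; split=> b; rewrite BE /= inE;
    [move=> [->|->]; rewrite ?eqxx ?orbT|move=> /orP[/eqP->|]; [left|right]].
apply/proj_indep_seq; rewrite /= ?as_ // /reprs /= free_cons.
rewrite BE in IB; move/(proj_indep_seq us): IB => -> /=; rewrite andbT.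
by apply/negP => /(subvP spV).
Qed.

(** Conversely, a point of the span of a basis that were missing from the flat
    would depend on that basis. *)
Lemma flat_eq_points A s : flat indepP A -> uniq s ->
  is_basis indepP A [set` s] -> A = points <<reprs s>>.
Proof.
move=> flA us bs; have [fs sA Asp] := (basis_seqP A us).1 bs.
apply/seteqP; split=> // a spa; rewrite -flA.
have [?|nAa] := pselect (A a); [by left|right; split=> //].
exists [set` s]; split=> //; first exact/proj_indep_seq.
move=> /proj_indepE/(_ (a :: s)); rewrite /= us andbT.
have -> /= : a \notin s by apply/negP => /sA.
rewrite /reprs /= free_cons (_ : (_ \in _)) //= => /(_ isT) notsub.
suff : false by []; apply: notsub => b; rewrite /= inE.
by move=> /orP[/eqP->|]; [left|right].
Qed.

End Points.

Arguments point {K L} v.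

(** * The submonoid-rank threshold *)

Section Consequences.
Variables (K : fieldType) (L : fieldExtType K).
Local Open Scope ring_scope.
Notation PG := (proj_group L).
Notation indepP := (@proj_indep K L).

Lemma enat_min_unique (S : set enat) m m' :
  is_enat_min S m -> is_enat_min S m' -> m = m'.
Proof.
move=> [Sm mS] [Sm' m'S]; move: (mS _ Sm') (m'S _ Sm).
by case: m {mS Sm} => [m|]; case: m' {m'S Sm'} => [m'|] //= le1 le2;
  congr Some; apply/eqP; rewrite eqn_leq le1 le2.
Qed.

(** Products of basis elements of [H] lie in [H], hence in the span of the
    basis; so this span is a subalgebra of [L], that is, a subfield. *)
Lemma submonoid_rank (H : set PG) : @submonoid (proj_indep_group L) H ->
  exists F : {subfield L}, rho indepP H = Some (\dim F).
Proof.
move=> [H1 HM]; have [s us bs] := basis_seq_exists H.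
have [_ sH Hsp] := (basis_seqP H us).1 bs; pose V := <<reprs s>>%VS.
have VP : is_aspace V.
  apply/andP; split; first by apply/has_algid1/points_one/Hsp.
  apply: prodv_span_sub => _ _ /mapP[a /sH Ha ->] /mapP[b /sH Hb ->].
  exact/points_mul/Hsp/HM.
by exists (ASpace VP); rewrite (rho_basis us bs).
Qed.

Lemma points_submonoid (F : {subfield L}) :
  @submonoid (proj_indep_group L) (points F).
Proof.
split=> [|a b aF bF]; first by apply/points_one/mem1v.
by apply/points_mul; exact: rpredM.
Qed.

Lemma subfield_neq1 (F : {subfield L}) :
  (F : {vspace L}) <> 1%VS <-> (1 < \dim F)%N.
Proof.
split=> [F1|lt1 F1]; last by rewrite F1 dimv1 in lt1.
rewrite ltnNge; apply/negP => le1; apply: F1; apply/eqP.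
by rewrite eq_sym eqEdim dimv1 le1 andbT sub1v.
Qed.

Lemma mu_proj_group : (1%VS : {vspace L}) <> fullv ->
  mu (proj_indep_group L) =
    enat_min [set Some (\dim F) | F in
      [set F : {subfield L} | (F : {vspace L}) <> 1%VS]].
Proof.
move=> KL; rewrite /mu; set S := (X in X `|` _); set S' := (X in _ = enat_min X).
have SE : S = S'.
  apply/seteqP; split=> [_ [H [Hm Hgt _] <-]|_ [F /= F1 <-]].
    have [F HF] := submonoid_rank Hm; exists F; rewrite /= ?HF //.
    by apply/subfield_neq1; move: Hgt; rewrite /= HF /enat_lt /= -ltnNge.
  exists (points F) => /=; last exact: rho_points.
  split; [exact: points_submonoid| |exact: rho_lt_infty].
  by rewrite rho_points /enat_lt /= -ltnNge; apply/subfield_neq1.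
have S'0 : S' !=set0 by exists (Some (\dim {:L})); exists {:L}%AS => //= /esym.
apply: (@enat_min_unique (S `|` [set einfty])).
  by apply: enat_minP; exists einfty; right.
have [mS' lemS'] := enat_minP S'0; rewrite SE; split; first by left.
by move=> m [/lemS'//|->]; case: (enat_min S').
Qed.

(** * Matching and intermediate fields *)

(** The flats of [F] and of [<[x]> + W] are not matched, where K + W = F is a
    direct sum and [x] is outside [F]. *)
Lemma matching_no_proper_subfield :
  matching_property (proj_indep_group L) -> no_proper_subfield L.
Proof.
move=> mP F; have [|F1] := pselect ((F : {vspace L}) = 1%VS); [by left|right].
apply/eqP; rewrite eqEsubv subvf /=; apply: contrapT => /negP/subvPn[x _ xF].
pose W := (F :\: 1)%VS; pose V := (<[x]> + W)%VS.
have WF : (W <= F)%VS by exact: diffvSl.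
have dimW : \dim F = (\dim W).+1.
  rewrite -(dimv_cap_compl F 1) (capv_idPr _) ?dimv1 //; exact: sub1v.
have xW : x \notin W by apply: contra xF; exact: (subvP WF).
have bV : basis_of V (x :: vbasis W).
  by rewrite /basis_of /V span_cons (span_basis (vbasisP W)) eqxx
    free_cons (span_basis (vbasisP W)) xW (basis_free (vbasisP W)).
have V1 : 1 \notin V.
  apply/negP => /memv_addP[_ /vlineP[k ->] [w wW eq1]].
  have [k0|k0] := eqVneq k 0.
    have : 1 \in (W :&: 1)%VS by rewrite memv_cap memv_line andbT eq1 k0 scale0r add0r.
    by rewrite capv_diff memv0 oner_eq0.
  have : k *: x \in F.
    by rewrite (_ : k *: x = 1 - w) ?rpredB ?mem1v ?(subvP WF) // eq1 addrK.
  by rewrite rpredZeq (negPf k0) (negPf xF).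
have dimV : \dim V = \dim F.
  by have /andP[/eqP<- /eqP->] := bV; rewrite /= size_tuple dimW.
have [w wW w0] : exists2 w, w \in vbasis W & w != 0.
  have W0 : (0 < size (vbasis W))%N.
    by rewrite size_tuple -ltnS -dimW; apply/subfield_neq1.
  exists (vbasis W)`_0; first exact: mem_nth.
  by apply: (free_not0 (basis_free (vbasisP W))); exact: mem_nth.
have [uX bX] := points_basis bV.
have [s us bs] := basis_seq_exists (points F).
have [_ sF _] := (basis_seqP _ us).1 bs.
have [||||//|f [[_ _ fsurj] fP]] := mP (points F) (points V) _ _ _ _ _ _ _ bs bX.
- exact: flat_points.
- exact: flat_points.
- exact: rho_lt_infty.
- by rewrite !rho_points dimV.
- by move=> /points_one; exact/negP.
have [|a sa fa] := fsurj (point w).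
  by rewrite /= inE (map_f point wW) orbT.
apply: (fP a sa); apply/points_mul; rewrite fa; apply: rpredM; first exact: sF.
by apply/points_point => //; apply: (subvP WF); exact: vbasis_mem.
Qed.

(** When Hall's condition fails for some elements a and b of the bases, all the
    products ab lie in [A]. Adding 1 to the span of the b's raises its dimension and keeps the
    products in [A], which is too small for that by the Cauchy-Davenport
    inequality. *)
Lemma no_proper_subfield_matching :
  no_proper_subfield L -> matching_property (proj_indep_group L).
Proof.
move=> nosub A B flA flB _ rhoAB B1 bA bB bAP bBP.
have [s us sE] := basis_seq bAP; have [t ut tE] := basis_seq bBP.
rewrite {}sE in bAP *; rewrite {}tE in bBP *.
have [fs _ _] := (basis_seqP _ us).1 bAP.
have [ft _ _] := (basis_seqP _ ut).1 bBP.
have [[IA _ _] [IB _ _]] := (bAP, bBP).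
set V := <<reprs s>>%VS; set W := <<reprs t>>%VS.
have AE : A = points V := flat_eq_points flA us bAP.
have BE : B = points W := flat_eq_points flB ut bBP.
have dimVW : \dim V = \dim W.
  by move: rhoAB; rewrite (rho_basis us bAP) (rho_basis ut bBP) => -[].
have st : size s = size t.
  by move: dimVW; rewrite (eqP fs) (eqP ft) !size_map.
have W1 : 1 \notin W by apply/negP => W1; apply: B1; rewrite BE; apply/points_one.
have [f [bij_f fP]] : exists f : PG -> PG, set_bij [set` s] [set` t] f /\
    {in s, forall a, val (repr a) * val (repr (f a)) \notin V}.
  pose r (a b : PG) := val (repr a) * val (repr b) \notin V.
  have := marriage_seq (r := r) us ut st; apply.
  move=> u v uu uv us' vt stuck.
  have fu := (proj_indepE _).1 IA u uu us'.
  have fv := (proj_indepE _).1 IB v uv vt.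
  have [->|u0] := eqVneq u [::]; first by rewrite uniq_leq_size.
  set U := <<reprs u>>%VS; set W' := <<reprs v>>%VS.
  have dimU : \dim U = size u by rewrite (eqP fu) size_map.
  have dimW' : \dim W' = size v by rewrite (eqP fv) size_map.
  have prod_sub : (U * (1 + W') <= V)%VS.
    rewrite prodvDr prodv1 subv_add; apply/andP; split.
      by apply/span_subvP => _ /mapP[a /us' sa ->]; exact/memv_span/map_f.
    apply: prodv_span_sub => _ _ /mapP[a au ->] /mapP[b bv ->].
    exact/negPn/stuck.
  have U0 : U != 0%VS by rewrite -dimv_eq0 dimU size_eq0.
  have dim1W' : \dim (1 + W') = (size v).+1.
    rewrite dimv_disjoint_sum ?dimv1 ?dimW' //; apply/eqP; rewrite -subv0.
    apply/subvP => x; rewrite memv_cap => /andP[/vlineP[k ->] kW].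
    have [->|k0] := eqVneq k 0; first by rewrite scale0r mem0v.
    move: kW; rewrite rpredZeq (negPf k0) /= => W'1.
    case/negP: W1; apply: (subvP _ _ W'1).
    by apply/span_subvP => _ /mapP[b /vt tb ->]; exact/memv_span/map_f.
  have in1 : 1 \in (1 + W')%VS by rewrite memvE addvSl.
  (* If V were L, W would be L for reasons of dimension, but it avoids 1. *)
  have Vprop : (\dim V < \dim {:L})%N.
    rewrite ltn_neqAle dimvS ?subvf // andbT; apply/negP => /eqP dimV.
    have : W == fullv by rewrite eqEdim subvf -dimVW dimV leqnn.
    by move=> /eqP WL; rewrite WL memvf in W1.
  have := leq_trans (linear_cauchy_davenport nosub U0 in1) (dimvS prod_sub).
  by rewrite geq_min leqNgt Vprop dimU dim1W' addnS /= dimVW (eqP ft) size_map.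
exists f; split=> // a sa; rewrite AE => /points_mul; apply/negP; exact: fP.
Qed.

End Consequences.

Theorem corollary7p10 (K : fieldType) (L : fieldExtType K)
    (KL : (1%VS : {vspace L}) <> fullv) :
  mu (proj_indep_group L) =
    enat_min [set Some (\dim F) | F in
      [set F : {subfield L} | (F : {vspace L}) <> 1%VS]]
  /\ (matching_property (proj_indep_group L) <->
      ~ exists F : {subfield L},
          (F : {vspace L}) <> 1%VS /\ (F : {vspace L}) <> fullv).
Proof.
split; first exact: mu_proj_group.
split=> [/matching_no_proper_subfield nosub [F [F1 FL]]|nex].
  by case: (nosub F).
apply: no_proper_subfield_matching => F.
have [|F1] := pselect ((F : {vspace L}) = 1%VS); [by left|right].
by apply: contrapT => FL; apply: nex; exists F.
Qed.
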